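(* Let $(\Omega,\mathcal{F},\mathbb{P})$ be a probability space and $\{\mathcal{F}_t\}_{t\in\mathbb{R}_+}$ a filtration (not assumed to satisfy the usual conditions) with $\bigvee_{t\in\mathbb{R}_+}\mathcal{F}_t\subseteq\mathcal{F}$. Let $\mathcal{A}$ be the accessible $\sigma$-algebra on $\Omega\times\mathbb{R}_+$. For every $A\in\mathcal{A}$ and every $\epsilon>0$ there exists an accessible time $\tau^{A,\epsilon}$ such that $[\![\tau^{A,\epsilon}]\!]\subseteq A$ and $$\mathbb{P}^*\left(\pi_\Omega(A)\right)-\mathbb{P}\left(\{\tau^{A,\epsilon}<\infty\}\right)\leq\epsilon .$$
   Context: $\mathbb{R}_+=[0,\infty)$. No completeness or right-continuity of the filtration is assumed. An optional time (stopping time) is a function $\tau:\Omega\to\mathbb{R}_+\cup\{\infty\}$ with $\{\tau\le t\}\in\mathcal{F}_t$ for all $t\in\mathbb{R}_+$. A predictable time is an optional time $\rho$ for which there exists a non-decreasing sequence of optional times $\{\rho_n\}_{n\in\mathbb{N}}$ such that, for all $n$, $\rho_n<\infty$, $\rho_n\le\rho$, and $\rho_n<\rho$ on $\{0<\rho\}$, and such that $\rho_n\nearrow\rho$; all these relations hold for every $\omega\in\Omega$ (no reference to $\mathbb{P}$). For a function $\tau:\Omega\to\mathbb{R}_+\cup\{\infty\}$, its graph is $[\![\tau]\!]=\{(\omega,\tau(\omega)):\omega\in\Omega,\ \tau(\omega)<\infty\}$, and $[\![\tau,\infty[\![=\{(\omega,t)\in\Omega\times\mathbb{R}_+:\tau(\omega)\le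 t\}$. An optional time $\tau$ is accessible if there exists a sequence of predictable times $\{\rho_m\}_{m\in\mathbb{N}}$ such that $[\![\tau]\!]\subseteq\bigcup_{m=1}^\infty[\![\rho_m]\!]$. The accessible $\sigma$-algebra is $\mathcal{A}=\sigma(\{[\![\tau,\infty[\![\,:\tau\text{ an accessible time}\})$. $\pi_\Omega:\Omega\times\mathbb{R}_+\to\Omega$ is the projection $\pi_\Omega(\omega,t)=\omega$. For $B\subseteq\Omega$, $\mathbb{P}^*(B)=\inf\{\mathbb{P}(E):B\subseteq E,\ E\in\mathcal{F}\}$. *)

(* Defs.v *)
From HB Require Import structures.
From mathcomp Require Import all_boot all_order all_algebra.
From mathcomp Require Import all_classical all_reals all_analysis.

Set Implicit Arguments.
Unset Strict Implicit.
Unset Printing Implicit Defensive.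

Import Order.TTheory GRing.Theory Num.Theory.
Import numFieldNormedType.Exports.

Local Open Scope classical_set_scope.
Local Open Scope ring_scope.
Local Open Scope ereal_scope.

(* The time axis [0, oo[ is the type {nonneg R}. Random times are functions
   T -> \bar R; their values lie in [0, +oo] by the first clause of
   [optional_time], while [graph] and [stoch_itv] only see nonnegative reals. *)

(* Neither completeness nor right-continuity is required. *)
Definition filtration (R : realType) (T : Type)
    (Fil : {nonneg R} -> set (set T)) : Prop :=
  (forall t, sigma_algebra setT (Fil t)) /\
  (forall s t, (s%:num <= t%:num)%R -> Fil s `<=` Fil t).

Definition optional_time (R : realType) (T : Type)
    (Fil : {nonneg R} -> set (set T)) (tau : T -> \bar R) : Prop :=
  (forall w, 0 <= tau w) /\
  (forall t : {nonneg R}, Fil t [set w | tau w <= t%:num%:E]).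

(* All relations hold for every w : no measure is involved. *)
Definition predictable_time (R : realType) (T : Type)
    (Fil : {nonneg R} -> set (set T)) (rho : T -> \bar R) : Prop :=
  optional_time Fil rho /\
  exists rho_ : nat -> T -> \bar R,
    [/\ forall n, optional_time Fil (rho_ n),
        forall n w, rho_ n w < +oo,
        forall n w, rho_ n w <= rho w,
        forall n w, 0 < rho w -> rho_ n w < rho w &
        forall w, nondecreasing_seq (rho_ ^~ w) /\
          (fun n => rho_ n w) @ \oo --> rho w].

Definition graph (R : realType) (T : Type) (tau : T -> \bar R) :
    set (T * {nonneg R}) :=
  [set p | tau p.1 = p.2%:num%:E].

(* the stochastic interval [[tau, oo[[ *)
Definition stoch_itv (R : realType) (T : Type) (tau : T -> \bar R) :
    set (T * {nonneg R}) :=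
  [set p | tau p.1 <= p.2%:num%:E].

Definition accessible_time (R : realType) (T : Type)
    (Fil : {nonneg R} -> set (set T)) (tau : T -> \bar R) : Prop :=
  optional_time Fil tau /\
  exists rho : nat -> T -> \bar R,
    (forall m, predictable_time Fil (rho m)) /\
    graph tau `<=` \bigcup_m graph (rho m).

Definition accessible_sigma_algebra (R : realType) (T : Type)
    (Fil : {nonneg R} -> set (set T)) : set (set (T * {nonneg R})) :=
  <<s [set stoch_itv tau | tau in accessible_time Fil] >>.

Definition outer_probability d (T : measurableType d) (R : realType)
    (P : probability T R) (B : set T) : \bar R :=
  ereal_inf [set P E | E in [set E | B `<=` E /\ measurable E]].

(* Main.v *)
Require Import Defs.
From HB Require Import structures.
From mathcomp Require Import all_boot all_order all_algebra.
From mathcomp Require Import all_classical all_reals all_analysis.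
From mathcomp Require Import lra.

Set Implicit Arguments.
Unset Strict Implicit.
Unset Printing Implicit Defensive.

Import Order.TTheory GRing.Theory Num.Theory.
Import numFieldNormedType.Exports.

Local Open Scope classical_set_scope.
Local Open Scope ring_scope.
Local Open Scope ereal_scope.

(** Off the graphs of countably many predictable times rho_m, an accessible set
    A coincides with a set B obtained by countable operations from the sets
    { (w, t) | tau w < t } with tau optional: for a generator [[tau, oo[[ it
    suffices to remove graphs that cover the graph of tau
    ([accessible_off_graphs]). On the graph of rho_m, the set A is itself the
    graph of an accessible time sigma_m, namely rho_m restricted to the event
    that (w, rho_m w) lies in A ([accessible_restriction]). So A is the union of
    the graphs of the sigma_m and of B' = B minus the graphs of the rho_m.

    The outer probability is continuous along increasing sequences
    ([outer_probability_bigcup]), hence B' together with sigma_0, ...,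
    sigma_(n-1) already projects onto more than P*(pi A) - eps for some n. With
    C the event that one of these n times is finite, Choquet's capacitability
    theorem ([capacitability]) for J(X) = P*(pi X `|` C) replaces B' by a
    decreasing intersection of members of a paving, at no loss beyond eps. It
    applies because B' is a Souslin set over that paving: the sets
    { (w, t) | tau w < t }, the graphs of predictable times and the complements
    of both are Souslin ([bianalytic_after], [bianalytic_graph]).

    The paving consists of the finite unions of rectangles F x [s, t] with F
    known at some time r < s, or r = s = 0. Since the start of such a rectangle
    is announced from r on, the debut of a finite union is a predictable time
    whose graph lies in the union ([elementary_debut]). Sections being compact,
    the debut of a decreasing intersection is the supremum of the debuts: it is
    predictable, its graph lies in the intersection, and it is finite on the
    intersection of the projections ([elementary_bigcap_section]). The required
    time is the minimum of this debut and of sigma_0, ..., sigma_(n-1). *)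

(** * Souslin sets and the capacitability theorem *)

Definition agree (N : nat) (s s' : nat -> nat) :=
  forall i, (i < N)%N -> s i = s' i.

Definition below (m s : nat -> nat) := forall i, (s i <= m i)%N.

(** Continuity of G for the product topology on sequences of naturals and the
    discrete topology on U. *)
Definition locally_determined (U : Type) (G : (nat -> nat) -> U) :=
  forall s, exists N, forall s', agree N s s' -> G s = G s'.

Lemma locally_determined_comp (U : Type) (G : (nat -> nat) -> U)
    (h : nat -> nat) :
  locally_determined G -> locally_determined (fun s => G (fun i => s (h i))).
Proof.
move=> Gloc s; have [N GN] := Gloc (fun i => s (h i)).
exists (\max_(i < N) (h i).+1)%N => s' ss'.
apply: GN => i iN; apply: ss'.
exact: (@leq_bigmax _ (fun i : 'I_N => (h i).+1) (Ordinal iN)).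
Qed.

(** Sequential compactness of the box of sequences below m, in the form of
    Koenig's lemma: t is the limit of s along an ultrafilter that contains the
    tails, which has to select one of the finitely many values allowed at each
    coordinate. *)
Lemma cluster_of_bounded (m : nat -> nat) (s : nat -> nat -> nat) :
  (forall n, below m (s n)) ->
  exists t, forall N k, exists2 n, (k <= n)%N & agree N t (s n).
Proof.
move=> sm.
have [U [UU ooU]] := @ultraFilterLemma nat \oo _.
have lim i : exists v, U [set n | s n i = v].
  have : U [set n | (s n i <= m i)%N] by apply: filterS filterT => n _; exact: sm.
  elim: (m i) => [|b IH] Ub.
    by exists 0%N; apply: filterS Ub => n /=; case: (s n i).
  have [Ub1|Ub1] := in_ultra_setVsetC [set n | s n i = b.+1] UU; first by exists b.+1.
  apply: IH; apply: filterS (filterI Ub Ub1) => n /= [].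
  by rewrite leq_eqVlt => /orP[/eqP|].
have [t Ut] := choice lim; exists t => N k.
have UN : U [set n | agree N t (s n)].
  elim: N => [|N IH]; first by apply: filterS filterT.
  apply: filterS (filterI IH (Ut N)) => n /= [tn stN] i.
  by rewrite ltnS leq_eqVlt => /orP[/eqP->|/tn].
have Uk : U [set n | (k <= n)%N] by apply: ooU; exact: nbhs_infty_ge.
by have [n [? ?]] := filter_ex (filterI Uk UN); exists n.
Qed.

(** Uniform continuity on a compact box. Only one of the two sequences has to lie
    in the box: a sequence of counterexamples clusters along its first
    components, and the second components follow. *)
Lemma fan (U : Type) (G : (nat -> nat) -> U) (m : nat -> nat) :
  locally_determined G ->
  exists N, forall s s', below m s -> agree N s s' -> G s = G s'.
Proof.
move=> Gloc; apply: contrapT => noN.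
have H N : exists p : (nat -> nat) * (nat -> nat),
    [/\ below m p.1, agree N p.1 p.2 & G p.1 <> G p.2].
  apply: contrapT => Hn; apply: noN; exists N => s s' sm ss'.
  by apply: contrapT => Gss'; apply: Hn; exists (s, s').
have {H}[p Hp] := choice H.
have [n|t Ht] := @cluster_of_bounded m (fun n => (p n).1); first by case: (Hp n).
have [N GN] := Gloc t.
have [n Nn tn] := Ht N N; have [_ pn] := Hp n; apply.
rewrite -(GN _ tn); apply: GN => i iN.
by rewrite tn// pn//; exact: leq_trans Nn.
Qed.

Section souslin.
Context (R : realType) (X : Type) (K : set (set X)).

(** A Souslin operation indexed by whole sequences rather than by their finite
    prefixes: local determination says that each F n reads a finite prefix, whose
    length may depend on the sequence. This flexibility makes countable unions
    and intersections mere reindexings. *)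
Definition souslin (B : set X) :=
  exists F : nat -> (nat -> nat) -> set X,
    [/\ forall n s, K (F n s),
        forall n, locally_determined (F n) &
        B = [set x | exists s, forall n, F n s x]].

Lemma souslin_paving (B : set X) : K B -> souslin B.
Proof.
move=> KB; exists (fun _ _ => B); split => //.
- by move=> n s; exists 0%N.
- by apply/seteqP; split=> x /=; [move=> ?; exists (fun=> 0%N)|case=> _ /(_ 0%N)].
Qed.

(** Coordinate 0 selects the set of the union, the other coordinates are its
    witness. *)
Lemma souslin_bigcup (B : nat -> set X) :
  (forall n, souslin (B n)) -> souslin (\bigcup_n B n).
Proof.
move=> /choice[F HF].
exists (fun n s => F (s 0%N) n (fun i => s i.+1)); split.
- by move=> n s; case: (HF (s 0%N)).
- move=> n s; have [_ /(_ n (fun i => s i.+1))[N FN] _] := HF (s 0%N).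
  exists N.+1 => s' ss'; rewrite -(ss' 0%N)//.
  by apply: FN => i iN; exact: ss'.
- apply/seteqP; split=> x /=.
  + case=> k _; have [_ _ ->] := HF k; case=> s Fs.
    by exists (fun i => if i is j.+1 then s j else k).
  + case=> s Fs; exists (s 0%N) => //; have [_ _ ->] := HF (s 0%N).
    by exists (fun i => s i.+1).
Qed.

(** A bijection between naturals and pairs packs countably many witnesses into
    one. *)
Lemma souslin_bigcap (B : nat -> set X) :
  (forall n, souslin (B n)) -> souslin (\bigcap_n B n).
Proof.
move=> /choice[F HF].
pose split n : nat * nat := odflt (0, 0)%N (unpickle n).
pose join (k j : nat) : nat := pickle (k, j).
have joinK k j : split (join k j) = (k, j) by rewrite /split /join pickleK.
exists (fun n s => F (split n).1 (split n).2 (fun i => s (join (split n).1 i))).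
split.
- by move=> n s; case: (HF (split n).1).
- move=> n; apply: (@locally_determined_comp _ (F (split n).1 (split n).2)).
  by case: (HF (split n).1).
- apply/seteqP; split=> x /=.
  + move=> Bx; have H k : exists s, forall n, F k n s x.
      by have := Bx k I; have [_ _ ->] := HF k.
    have {H}[s Hs] := choice H.
    exists (fun i => s (split i).1 (split i).2) => n.
    suff -> : (fun i => s (split (join (split n).1 i)).1
                          (split (join (split n).1 i)).2) = s (split n).1.
      exact: Hs.
    by apply/funext => i; rewrite joinK.
  + case=> s Fs k _; have [_ _ ->] := HF k.
    by exists (fun i => s (join k i)) => n; have := Fs (join k n); rewrite joinK.
Qed.

(** Souslin sets need not be stable under complements; those whose complement is
    Souslin as well form a sigma-algebra. *)
Definition bisouslin : set (set X) :=
  [set B | souslin B /\ souslin (~` B)].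

Lemma souslin_setU (A B : set X) : souslin A -> souslin B -> souslin (A `|` B).
Proof.
move=> sA sB.
have -> : A `|` B = \bigcup_n (if n == 0%N then A else B).
  apply/seteqP; split=> x /=; first by case=> ?; [exists 0%N|exists 1%N].
  by case=> -[|n] _ ?; [left|right].
by apply: souslin_bigcup => -[|n].
Qed.

Hypothesis K0 : K set0.

Lemma sigma_algebra_bisouslin :
  souslin setT -> sigma_algebra setT bisouslin.
Proof.
move=> sT; split.
- by split; [exact: souslin_paving|rewrite setC0].
- by move=> A [sA sCA]; split; rewrite setTD// setCK.
- move=> A HA; split; first by apply: souslin_bigcup => n; case: (HA n).
  by rewrite setC_bigcup; apply: souslin_bigcap => n; case: (HA n).
Qed.

Hypothesis KU : forall A B, K A -> K B -> K (A `|` B).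
Hypothesis KI : forall A B, K A -> K B -> K (A `&` B).

Lemma paving_bounded_union (G : nat -> set X) b :
  (forall v, K (G v)) -> K [set x | exists2 v, (v <= b)%N & G v x].
Proof.
move=> KG; elim: b => [|b IH].
  rewrite [X in K X](_ : _ = G 0%N)//; apply/seteqP; split=> x /=.
  - by case=> -[|v].
  - by move=> ?; exists 0%N.
rewrite [X in K X](_ : _ = [set x | exists2 v, (v <= b)%N & G v x] `|` G b.+1).
  exact: KU.
apply/seteqP; split=> x /=.
- case=> v; rewrite leq_eqVlt => /orP[/eqP->|vb Gv]; first by right.
  by left; exists v.
- case; last by exists b.+1.
  by case=> v vb Gv; exists v => //; exact: leqW.
Qed.

(** When G reads N coordinates only, the union over the infinite box is a finite
    one; it is unfolded one coordinate at a time. *)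
Lemma paving_box_union N m (G : (nat -> nat) -> set X) :
  (forall s, K (G s)) ->
  (forall s s', below m s -> agree N s s' -> G s = G s') ->
  K [set x | exists2 s, below m s & G s x].
Proof.
elim: N m G => [|N IH] m G KG GN.
  rewrite [X in K X](_ : _ = G m)//; apply/seteqP; split=> x /=.
  - by case=> s sm; rewrite (GN s m).
  - by move=> ?; exists m => // i.
pose cons v (s : nat -> nat) i := if i is j.+1 then s j else v.
rewrite [X in K X](_ : _ = [set x | exists2 v, (v <= m 0)%N &
    [set x | exists2 s, below (fun i => m i.+1) s &
       (if (v <= m 0)%N then G (cons v s) else set0) x] x]).
  apply: paving_bounded_union => v; apply: IH => [s|s s' sm ss'].
    by case: ifP.
  case: ifP => // vm; apply: GN; first by case.
  by case=> //= i iN; exact: ss'.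
apply/seteqP; split=> x /=.
- case=> s sm Gs; exists (s 0%N); first exact: sm.
  exists (fun i => s i.+1); first by move=> i; exact: sm.
  rewrite sm; suff -> : cons (s 0%N) (fun i => s i.+1) = s by [].
  by apply/funext; case.
- case=> v vm [s sm]; rewrite vm => Gs; exists (cons v s) => //.
  by case.
Qed.

(** Choquet's theorem. Bounding the coordinates of the witnesses one after the
    other, by up-continuity of J, gives m such that the witnesses with the first N
    coordinates below m still carry J-mass greater than c, for each N. The n-th
    set of the sequence keeps the stages up to n and requires all coordinates to
    be below m: it is a finite union of members of the paving, and Koenig's lemma
    puts the intersection of these sets inside B. *)
Lemma capacitability (J : set X -> \bar R) (c : \bar R) (B : set X) :
  (forall A B, A `<=` B -> J A <= J B) ->
  (forall B_ : nat -> set X, (forall n, B_ n `<=` B_ n.+1) ->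
    c < J (\bigcup_n B_ n) -> exists n, c < J (B_ n)) ->
  souslin B -> c < J B ->
  exists K_ : nat -> set X,
    [/\ forall n, K (K_ n), forall n, K_ n.+1 `<=` K_ n,
        forall n, c < J (K_ n) & \bigcap_n K_ n `<=` B].
Proof.
move=> Jmono Jup [F [KF Floc BE]] cB.
(* [part S] consists of the points of B that have a witness in S, and [S n]
   bounds the first n coordinates by values that keep the mass above c *)
pose part (S : set (nat -> nat)) := [set x | exists2 s, S s & forall n, F n s x].
have bnd (nS : nat * set (nat -> nat)) : exists v,
    c < J (part nS.2) -> c < J (part (nS.2 `&` [set s | (s nS.1 <= v)%N])).
  have [cS|ncS] := pselect (c < J (part nS.2)); last by exists 0%N => /ncS.
  have [v||v cv] := Jup (fun v => part (nS.2 `&` [set s | (s nS.1 <= v)%N])).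
  - by move=> x [s [Ss sv] Fs]; exists s => //; split => //=; exact: leqW.
  - apply: lt_le_trans cS _; apply: Jmono => x [s Ss Fs].
    by exists (s nS.1) => //; exists s => //; split => /=.
  - by exists v.
have {bnd}[g Hg] := choice bnd.
pose S := fix S n := if n is k.+1 then
  S k `&` [set s | (s k <= g (k, S k))%N] else setT.
pose m k := g (k, S k).
have SE n : S n = [set s | forall i, (i < n)%N -> (s i <= m i)%N].
  elim: n => [|n IH]; apply/seteqP; split => s //=.
  - rewrite {1}IH => -[Ss sn] i; rewrite ltnS leq_eqVlt => /orP[/eqP->//|].
    exact: Ss.
  - move=> sm; split; last exact: sm.
    by rewrite IH => i iN; exact/sm/ltnW.
have cS n : c < J (part (S n)).
  elim: n => [|n IH]; last exact: (Hg (n, S n) IH).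
  rewrite (_ : part _ = B)// BE; apply/seteqP; split=> x [s].
  - by move=> _ Fs; exists s.
  - by exists s.
(* stage 0 is always imposed, so that [G n s] is a member of the paving even
   when the whole space is not *)
pose G n (s : nat -> nat) := [set x | forall j, (j <= n)%N -> F j s x].
exists (fun n => [set x | exists2 s, below m s & G n s x]).
have Gfan n : exists N, forall s s', below m s -> agree N s s' -> G n s = G n s'.
  have /choice[N HN] : forall j, exists N, forall s s', below m s ->
    agree N s s' -> F j s = F j s' by move=> j; exact: fan.
  exists (\max_(j < n.+1) N j)%N => s s' sm ss'.
  have E j : (j <= n)%N -> F j s = F j s'.
    rewrite -ltnS => jn; apply: HN => // i ij; apply: ss'.
    apply: leq_trans ij _.
    exact: (@leq_bigmax _ (fun j : 'I_n.+1 => N j) (Ordinal jn)).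
  by apply/seteqP; split=> x Gx j jn; have := Gx j jn; rewrite E.
split.
- move=> n; have [N GN] := Gfan n; apply: (@paving_box_union N) => // s.
  elim: n {GN Gfan} => [|n IH].
    rewrite [X in K X](_ : _ = F 0%N s)//; apply/seteqP; split=> x /=.
      exact.
    by move=> ? [|].
  rewrite [X in K X](_ : _ = G n s `&` F n.+1 s); first exact: KI.
  apply/seteqP; split=> x /=.
    by move=> H; split=> [j jn|]; apply: H => //; exact: leqW.
  by move=> [Gx Fx] j; rewrite leq_eqVlt => /orP[/eqP->//|]; exact: Gx.
- by move=> n x /= [s sm Gs]; exists s => // j jn; apply: Gs; exact: leqW.
- move=> n; have [N GN] := Gfan n.
  apply: lt_le_trans (cS N) _; apply: Jmono => x [s]; rewrite SE /= => sm Fs.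
  (* beyond the coordinates read up to stage n, the witness may be reset to 0,
     which brings it below m everywhere *)
  pose s' i := if (i < N)%N then s i else 0%N.
  have s'm : below m s' by move=> i; rewrite /s'; case: ifP => // /sm.
  exists s' => //; rewrite (GN s' s) => //.
  by move=> i iN; rewrite /s' iN.
- move=> x Kx; have H n : exists s, below m s /\ G n s x.
    by have [s] := Kx n I; exists s.
  have {H}[s Hs] := choice H.
  have [n|t Ht] := @cluster_of_bounded m s; first by case: (Hs n).
  rewrite BE; exists t => n; have [N FN] := Floc n t.
  have [k nk tk] := Ht N n; have [_ Gk] := Hs k.
  by rewrite (FN _ tk); exact: Gk.
Qed.

End souslin.

(** * Auxiliary facts on extended reals and sigma-algebras *)

Lemma nondecreasing_ecvgP (R : realType) (u : nat -> \bar R) (l : \bar R) :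
  nondecreasing_seq u -> (forall n, u n <= l) ->
  (u @ \oo --> l) <-> (forall c, c < l -> exists n, c < u n).
Proof.
move=> ndu ul; split.
- move=> cvu c cl; apply: contrapT => noN.
  have : l <= c.
    apply: cvge_to_le cvu _; apply: nearW => n.
    by rewrite leNgt; apply/negP => cu; apply: noN; exists n.
  by rewrite leNgt cl.
- move=> H; suff -> : l = ereal_sup (range u) by exact: ereal_nondecreasing_cvgn.
  apply/eqP; rewrite eq_le; apply/andP; split.
  + rewrite leNgt; apply/negP => /H[n]; rewrite ltNge => /negP; apply.
    by apply: ereal_sup_ubound; exists n.
  + by apply: ge_ereal_sup => _ [n _ <-].
Qed.

(** The times are indexed by all naturals through the countability of the
    rationals; absolute values force nonnegativity and do not affect the
    rationals that separate a from b. *)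
Lemma countable_dense_times (R : realType) : exists q : nat -> {nonneg R},
  forall a b : \bar R, 0 <= a -> a < b ->
    exists n, a < (q n)%:num%:E /\ (q n)%:num%:E < b.
Proof.
exists (fun n => NngNum (normr_ge0 (ratr (odflt 0%R (unpickle n : option rat)) : R))).
have key (x y : R) : (0 <= x)%R -> (x < y)%R -> exists n,
    (x < `|ratr (odflt 0%R (unpickle n : option rat))| < y)%R.
  move=> x0 /rat_in_itvoo[q]; rewrite in_itv/= => /andP[xq qy].
  exists (pickle q); rewrite pickleK/= ger0_norm ?xq//.
  exact/ltW/(le_lt_trans x0).
case=> [x| |] [y| |] //=; rewrite ?lee_fin ?lte_fin.
- by move=> x0 /(key _ _ x0)[n /andP[? ?]]; exists n; rewrite !lte_fin.
- move=> x0 _; have [|n /andP[? ?]] := key x (x + 1)%R x0; first by rewrite ltrDl.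
  by exists n; rewrite !lte_fin; split=> //; rewrite ltry.
Qed.

Section sigma_algebra_closure.
Context (X : Type) (G : set (set X)).
Hypothesis GS : sigma_algebra setT G.

Lemma salg_set0 : G set0.
Proof. by case: GS. Qed.

Lemma salg_setC A : G A -> G (~` A).
Proof. by case: GS => _ GC _; rewrite -setTD; exact: GC. Qed.

Lemma salg_setT : G setT.
Proof. by rewrite -setC0; exact/salg_setC/salg_set0. Qed.

Lemma salg_bigcup (A : nat -> set X) : (forall n, G (A n)) -> G (\bigcup_n A n).
Proof. by case: GS => _ _; exact. Qed.

Lemma salg_bigcap (A : nat -> set X) : (forall n, G (A n)) -> G (\bigcap_n A n).
Proof.
move=> GA; rewrite -[X in G X]setCK setC_bigcap; apply: salg_setC.
by apply: salg_bigcup => n; exact: salg_setC.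
Qed.

Lemma salg_setU A B : G A -> G B -> G (A `|` B).
Proof.
move=> GA GB; have -> : A `|` B = \bigcup_n (if n == 0%N then A else B).
  apply/seteqP; split=> x /=; first by case=> ?; [exists 0%N|exists 1%N].
  by case=> -[|n] _ ?; [left|right].
by apply: salg_bigcup => -[|n].
Qed.

Lemma salg_setI A B : G A -> G B -> G (A `&` B).
Proof.
move=> GA GB; rewrite -[X in G X]setCK setCI; apply: salg_setC.
by apply: salg_setU; exact: salg_setC.
Qed.

Lemma salg_prop (p : Prop) : G [set _ | p].
Proof.
have [hp|hp] := pselect p.
- rewrite (_ : [set _ | p] = setT); first exact: salg_setT.
  by apply/seteqP; split.
- rewrite (_ : [set _ | p] = set0); first exact: salg_set0.
  by apply/seteqP; split.
Qed.

End sigma_algebra_closure.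

(** * Optional and predictable times *)

Section times.
Context (R : realType) (T : Type) (Fil : {nonneg R} -> set (set T)).
Hypothesis hFil : filtration Fil.

Lemma filtration_salg t : sigma_algebra setT (Fil t).
Proof. by case: hFil. Qed.

Lemma fil_le s t A : (s%:num <= t%:num)%R -> Fil s A -> Fil t A.
Proof. by case: hFil => _ H st; exact: H. Qed.

(** Before r neither value has been reached, and from r on the event F is known. *)
Lemma optional_if (r : {nonneg R}) F (u v : \bar R) :
  Fil r F -> r%:num%:E <= u -> r%:num%:E <= v ->
  optional_time Fil (fun w => if w \in F then u else v).
Proof.
move=> FF ru rv; split=> [w|t].
  by case: ifP => _; [apply: le_trans ru|apply: le_trans rv]; rewrite lee_fin.
have [rt|tr] := leP r%:num t%:num; last first.
  rewrite [X in Fil t X](_ : _ = set0); first exact: (salg_set0 (filtration_salg _)).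
  apply/seteqP; split=> w //=; case: ifP => _.
    by rewrite leNgt (lt_le_trans _ ru)// lte_fin.
  by rewrite leNgt (lt_le_trans _ rv)// lte_fin.
rewrite [X in Fil t X](_ : _ =
  (F `&` [set _ | u <= t%:num%:E]) `|` (~` F `&` [set _ | v <= t%:num%:E])).
  have FS := filtration_salg t.
  by apply: (salg_setU FS); apply: (salg_setI FS); try exact: (salg_prop FS);
    [|apply: (salg_setC FS)]; exact: fil_le FF.
apply/seteqP; split=> w /=; case: ifPn.
- by rewrite inE => ? ?; left.
- by rewrite notin_setE => ? ?; right.
- by rewrite inE => ? [[]|[]].
- by rewrite notin_setE => ? [[]|[]].
Qed.

Lemma optional_min sigma tau : optional_time Fil sigma -> optional_time Fil tau ->
  optional_time Fil (fun w => mine (sigma w) (tau w)).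
Proof.
move=> [s0 sF] [t0 tF]; split=> [w|t]; first by rewrite le_min s0 t0.
rewrite [X in Fil t X](_ : _ = [set w | sigma w <= t%:num%:E] `|`
  [set w | tau w <= t%:num%:E]); first exact: (salg_setU (filtration_salg _)).
apply/seteqP; split=> w /=; rewrite ge_min; first by move/orP.
by move=> H; apply/orP.
Qed.

Lemma optional_sup (D : nat -> T -> \bar R) :
  (forall n, optional_time Fil (D n)) ->
  optional_time Fil (fun w => ereal_sup (range (D ^~ w))).
Proof.
move=> HD; split=> [w|t].
  have [D0 _] := HD 0%N; apply: le_trans (D0 w) _.
  by apply: ereal_sup_ubound; exists 0%N.
rewrite [X in Fil t X](_ : _ = \bigcap_n [set w | D n w <= t%:num%:E]).
  by apply: (salg_bigcap (filtration_salg _)) => n; case: (HD n).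
apply/seteqP; split=> w /=.
- by move=> Dt n _ /=; apply: le_trans Dt; apply: ereal_sup_ubound; exists n.
- by move=> H; apply: ge_ereal_sup => _ [n _ <-]; exact: H.
Qed.

(** For a nondecreasing sequence below rho, convergence to rho is the property
    that every c < rho is exceeded, which passes to minima and suprema without
    any topology. *)
Definition announces (a : nat -> T -> \bar R) (rho : T -> \bar R) :=
  [/\ forall n, optional_time Fil (a n),
      forall n w, a n w < +oo /\ a n w <= rho w,
      forall n w, 0 < rho w -> a n w < rho w,
      forall w, nondecreasing_seq (a ^~ w) &
      forall w c, c < rho w -> exists n, c < a n w].

Lemma predictable_timeP rho : predictable_time Fil rho <->
  optional_time Fil rho /\ exists a, announces a rho.
Proof.
split=> -[rhoF [a]].
- move=> [aF afin ale alt acvg]; split=> //; exists a; split => //.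
    by move=> w; case: (acvg w).
  by move=> w; have [nd /(nondecreasing_ecvgP nd)] := acvg w; apply.
- move=> [aF afin alt nda acvg]; split=> //; exists a; split => //.
  + by move=> n w; case: (afin n w).
  + by move=> n w; case: (afin n w).
  + move=> w; split; first exact: nda.
    apply/(nondecreasing_ecvgP (nda w)); last exact: acvg.
    by move=> n; case: (afin n w).
Qed.

Lemma predictable_min sigma tau :
  predictable_time Fil sigma -> predictable_time Fil tau ->
  predictable_time Fil (fun w => mine (sigma w) (tau w)).
Proof.
move=> /predictable_timeP[sF [a [aF afin alt nda acvg]]].
move=> /predictable_timeP[tF [b [bF bfin blt ndb bcvg]]].
apply/predictable_timeP; split; first exact: optional_min.
exists (fun n w => mine (a n w) (b n w)); split.
- by move=> n; exact: optional_min.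
- move=> n w; have [? ?] := afin n w; have [? ?] := bfin n w; split.
    by rewrite gt_min; apply/orP; left.
  by rewrite le_min !ge_min; apply/andP; split; apply/orP; [left|right].
- move=> n w; rewrite lt_min => /andP[s0 t0].
  by rewrite lt_min !gt_min alt// blt// orbT.
- move=> w n k nk; rewrite le_min !ge_min; apply/andP; split; apply/orP.
    by left; exact: nda.
  by right; exact: ndb.
- move=> w c; rewrite lt_min => /andP[/acvg[n cn] /bcvg[k ck]].
  exists (maxn n k); rewrite lt_min; apply/andP; split.
    by apply: lt_le_trans cn _; apply: nda; exact: leq_maxl.
  by apply: lt_le_trans ck _; apply: ndb; exact: leq_maxr.
Qed.

(** With a k announcing D k, the supremum is announced at stage n by the maximum
    of the first n + 1 values a k n. Where D k vanishes so does a k n, and it is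
    then below any positive supremum. *)
Lemma predictable_sup (D : nat -> T -> \bar R) :
  (forall n, predictable_time Fil (D n)) ->
  predictable_time Fil (fun w => ereal_sup (range (D ^~ w))).
Proof.
move=> HD; apply/predictable_timeP; split.
  by apply: optional_sup => n; case: (HD n).
have {HD}/choice[a Ha] k : exists a, announces a (D k).
  by have /predictable_timeP[] := HD k.
have Dsup k w : D k w <= ereal_sup (range (D ^~ w)).
  by apply: ereal_sup_ubound; exists k.
exists (fun n w => \big[maxe/0]_(k < n.+1) a k n w).
have alea n k w : (k <= n)%N -> a k n w <= \big[maxe/0]_(k < n.+1) a k n w.
  rewrite -ltnS => kn.
  exact: (@le_bigmax _ _ _ 0 (fun k : 'I_n.+1 => a k n w) (Ordinal kn)).
have sup0 w : 0 <= ereal_sup (range (D ^~ w)).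
  apply: le_trans (Dsup 0%N w); have [aF afin _ _ _] := Ha 0%N.
  by have [_] := afin 0%N w; apply: le_trans; case: (aF 0%N).
split.
- move=> n; split=> [w|t].
    apply: le_trans (alea n 0%N w isT).
    by have [aF _ _ _ _] := Ha 0%N; case: (aF n).
  rewrite [X in Fil t X](_ : _ = \bigcap_k
     (if (k <= n)%N then [set w | a k n w <= t%:num%:E] else setT)).
    have FS := filtration_salg t.
    apply: (salg_bigcap FS) => k; case: ifP => _; last exact: (salg_setT FS).
    by have [aF _ _ _ _] := Ha k; case: (aF n).
  apply/seteqP; split=> w /=.
    move=> /bigmax_leP[_ H] k _; case: ifPn => //= kn; rewrite -ltnS in kn.
    exact: (H (Ordinal kn)).
  move=> H; apply/bigmax_leP; split; first by rewrite lee_fin.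
  by move=> -[k /= kn] _; have := H k I; rewrite -ltnS kn.
- move=> n w; split.
    apply/bigmax_ltP; split=> // k _; have [_ afin _ _ _] := Ha k.
    by case: (afin n w).
  apply/bigmax_leP; split => // k _; apply: le_trans (Dsup k w).
  by have [_ afin _ _ _] := Ha k; case: (afin n w).
- move=> n w pos; apply/bigmax_ltP; split => // k _.
  have [_ afin alt _ _] := Ha k; have [D0|D0] := ltP 0 (D k w).
    by apply: lt_le_trans (Dsup k w); exact: alt.
  by apply: le_lt_trans pos; apply: le_trans D0; case: (afin n w).
- move=> w n p np; apply/bigmax_leP; split.
    by apply: le_trans (alea p 0%N w isT); have [aF _ _ _ _] := Ha 0%N; case: (aF p).
  move=> k _; apply: le_trans (alea p k w _).
    by have [_ _ _ nda _] := Ha k; exact: nda.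
  by apply: leq_trans np; rewrite -ltnS.
- move=> w c /ereal_sup_gt[_ [k _ <-]] cD.
  have [_ _ _ nda acvg] := Ha k; have [n cn] := acvg w c cD.
  exists (maxn n k); apply: lt_le_trans cn _.
  apply: le_trans (alea _ k w (leq_maxr _ _)).
  by apply: nda; exact: leq_maxl.
Qed.

(** On F the time s is announced by s - (s - r) / (n + 1), which stays in [r, s[
    when 0 < s and is 0 when s = 0; off F, oo is announced by r + n. All these
    values are at least r, when F is known. *)
Lemma predictable_rectangle (r s : {nonneg R}) F : Fil r F ->
  (r%:num <= s%:num)%R -> (0 < s%:num -> r%:num < s%:num)%R ->
  predictable_time Fil (fun w => if w \in F then s%:num%:E else +oo).
Proof.
move=> FF rs rs'; apply/predictable_timeP; split.
  by apply: optional_if FF _ _; rewrite ?lee_fin// leey.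
pose x n := (s%:num - (s%:num - r%:num) / n.+1%:R)%R.
have sr0 : (0 <= s%:num - r%:num)%R by rewrite subr_ge0.
have xs n : (x n <= s%:num)%R by rewrite gerBl divr_ge0.
have rx n : (r%:num <= x n)%R.
  rewrite lerBrDr -lerBrDl ler_pdivrMr// ler_peMr//.
  by rewrite ler1n.
exists (fun n w => if w \in F then (x n)%:E else (r%:num + n%:R)%:E); split.
- by move=> n; apply: optional_if FF _ _; rewrite lee_fin// lerDl.
- move=> n w; split; case: ifP => _; rewrite ?ltry ?leey// lee_fin//.
- move=> n w; case: ifP => _; rewrite ?ltry// !lte_fin => /rs' lrs.
  by rewrite gtrBl divr_gt0// subr_gt0.
- move=> w n k nk; case: ifP => _; rewrite lee_fin.
    by rewrite lerB// ler_wpM2l// lef_pV2 ?posrE// ler_nat.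
  by rewrite lerD2l ler_nat.
- move=> w [c| |]; case: ifP => _ //; rewrite ?lte_fin.
  + move=> cs; have sc : (0 < s%:num - c)%R by rewrite subr_gt0.
    (* chosen so that (s - r) / (n + 1) < s - c *)
    pose n := Num.truncn ((s%:num - r%:num) / (s%:num - c)).
    exists n; rewrite lte_fin /x ltrBrDl -ltrBrDr ltr_pdivrMr//.
    rewrite mulrC -ltr_pdivrMr//.
    by rewrite truncnS_gt.
  + move=> _; exists (Num.truncn c).+1; rewrite lte_fin.
    by apply: lt_le_trans (truncnS_gt c) _; rewrite lerDr.
  + by exists 0%N; rewrite ltNyr.
  + by exists 0%N; rewrite ltNyr.
Qed.

End times.

(** * The paving of rectangles *)

Lemma nonneg_time (R : realType) (x : \bar R) : 0 <= x -> x < +oo ->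
  exists t : {nonneg R}, x = t%:num%:E.
Proof. by case: x => [x| |]//; rewrite lee_fin => x0 _; exists (NngNum x0). Qed.

Lemma subset_nonincreasing (X : Type) (K : nat -> set X) :
  (forall n, K n.+1 `<=` K n) -> forall n k, (n <= k)%N -> K k `<=` K n.
Proof.
move=> KS; apply: (@homo_leq _ K (fun A B => B `<=` A)) KS => [L //|L L1 L2 H1 H2].
exact: subset_trans H2 H1.
Qed.

Lemma max_lt_max (R : realType) (r r' s s' : R) :
  (0 <= r)%R -> (0 <= r')%R -> (r <= s)%R -> (r' <= s')%R ->
  ((0 < s)%R -> (r < s)%R) -> ((0 < s')%R -> (r' < s')%R) ->
  (0 < Num.max s s')%R -> (Num.max r r' < Num.max s s')%R.
Proof.
move=> r0 r0' rs rs' rs1 rs1'; rewrite gt_max.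
have [ss'|s's] := leP s s' => pos; apply/andP; split; [|exact: rs1'|exact: rs1|].
- by have [/rs1 lrs|s0] := ltP 0%R s; [exact: lt_le_trans ss'|lra].
- by have [/rs1' lrs|s0] := ltP 0%R s'; [exact: lt_trans s's|lra].
Qed.

Section elementary.
Context (R : realType) (T : Type) (Fil : {nonneg R} -> set (set T)).
Hypothesis hFil : filtration Fil.
Implicit Types (K L : set (T * {nonneg R})) (F : set T) (r s t u : {nonneg R}).

Definition time0 : {nonneg R} := NngNum (lexx (0%R : R)).

Definition rectangle F s t : set (T * {nonneg R}) :=
  [set p | F p.1 /\ (s%:num <= p.2%:num <= t%:num)%R].

(** The start s of a rectangle over an event known at time r must come strictly
    later than r, except at time 0, which a predictable time may take without
    being announced from below. *)
Definition announced_start r s :=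
  (r%:num <= s%:num)%R /\ (0 < s%:num -> r%:num < s%:num)%R.

(** The finite unions of rectangles with announced start. Requiring s <= t makes
    the start of a rectangle the debut of its sections. *)
Inductive elementary : set (T * {nonneg R}) -> Prop :=
| elementary0 : elementary set0
| elementary_cons r s t F K : Fil r F -> announced_start r s ->
    (s%:num <= t%:num)%R -> elementary K ->
    elementary (rectangle F s t `|` K).

Lemma elementary_rectangle r s t F : Fil r F -> announced_start r s ->
  elementary (rectangle F s t).
Proof.
move=> FF rs; have [st|ts] := leP s%:num t%:num.
  by rewrite -[X in elementary X]setU0; apply: elementary_cons elementary0; eauto.
rewrite (_ : rectangle F s t = set0); first exact: elementary0.
apply/seteqP; split=> -[w v] //= [_ /andP[sv vt]].
by have := le_lt_trans (le_trans sv vt) ts; rewrite ltxx.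
Qed.

Lemma elementary_setU K L : elementary K -> elementary L -> elementary (K `|` L).
Proof.
move=> + EL; elim=> [|r s t F K' FF rs st _ IH]; first by rewrite set0U.
by rewrite -setUA; exact: elementary_cons FF rs st IH.
Qed.

Lemma max_time s s' : exists u, u%:num = Num.max s%:num s'%:num.
Proof. by have [ss'|ss'] := leP s%:num s'%:num; [exists s'|exists s]. Qed.

(** Two rectangles meet in a rectangle that starts at the maximum of the starts,
    over an event known at the maximum of the two times r and r'; by [max_lt_max]
    the new start is still announced. *)
Lemma elementary_setI_rectangle r s t F K : Fil r F -> announced_start r s ->
  elementary K -> elementary (rectangle F s t `&` K).
Proof.
move=> FF rs; elim=> [|r' s' t' F' K' FF' rs' _ _ IH].
  by rewrite setI0; exact: elementary0.
rewrite setIUr; apply: elementary_setU IH.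
have [r2 r2E] := max_time r r'; have [s2 s2E] := max_time s s'.
pose t2 := if (t%:num <= t'%:num)%R then t else t'.
have -> : rectangle F s t `&` rectangle F' s' t' = rectangle (F `&` F') s2 t2.
  have t2E : t2%:num = Num.min t%:num t'%:num by rewrite /t2; case: leP.
  rewrite /rectangle s2E t2E; apply/seteqP; split=> -[w v] /=; rewrite ge_max le_min.
    by move=> [[? /andP[-> ->]] [? /andP[-> ->]]].
  by move=> [[? ?] /andP[/andP[? ?] /andP[? ?]]]; split; split=> //; apply/andP.
apply: (@elementary_rectangle r2).
- by apply: (salg_setI (filtration_salg hFil _)); [apply: fil_le FF|apply: fil_le FF'] => //;
    rewrite r2E le_max lexx ?orbT.
- case: rs rs' => [rs rs1] [rs' rs1']; split; rewrite r2E s2E.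
    by rewrite ge_max !le_max rs rs' orbT.
  exact: max_lt_max.
Qed.

Lemma elementary_setI K L : elementary K -> elementary L -> elementary (K `&` L).
Proof.
move=> + EL; elim=> [|r s t F K' FF rs st _ IH].
  by rewrite set0I; exact: elementary0.
rewrite setIUl; apply: elementary_setU IH.
exact: elementary_setI_rectangle FF rs EL.
Qed.

(** For every w, rho w is the least time of the section of K at w, attained, or
    oo when that section is empty; the first clause forces the latter. *)
Definition debut (rho : T -> \bar R) K :=
  graph rho `<=` K /\ forall p, K p -> rho p.1 <= p.2%:num%:E.

Lemma elementary_debut K : elementary K ->
  exists rho, predictable_time Fil rho /\ debut rho K.
Proof.
elim=> [|r s t F K' FF [rs rs1] st _ [rho [rhoP [rhoK rhole]]]].
  exists (fun w => if w \in set0 then time0%:num%:E else +oo); split.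
    apply: (@predictable_rectangle _ _ _ hFil time0 time0) => //.
    exact: (salg_set0 (filtration_salg hFil _)).
  by split=> // -[w v]; rewrite /graph /= in_set0.
exists (fun w => mine (if w \in F then s%:num%:E else +oo) (rho w)); split.
  by apply: predictable_min => //; exact: predictable_rectangle FF rs rs1.
split=> [[w v]|[w v] /=].
- rewrite /graph /= => E; have [wr|wr] := leP (rho w) (if w \in F then s%:num%:E else +oo).
    by right; apply: rhoK; rewrite /graph /= -E; apply/esym/min_idPr.
  left; move: E; rewrite min_l ?(ltW wr)//.
  case: ifP => //; rewrite inE => Fw [sv]; split => //=.
  by rewrite -sv lexx st.
- rewrite ge_min => -[[/= Fw /andP[sv _]]|/rhole /= ->]; last by rewrite orbT.
  by rewrite mem_set// lee_fin sv.
Qed.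

(** The part of the closedness of sections that limits of increasing sequences
    use. *)
Lemma elementary_left_closed K w s : elementary K ->
  (forall c : R, (c < s%:num)%R ->
     exists u, K (w, u) /\ (c < u%:num <= s%:num)%R) ->
  K (w, s).
Proof.
elim=> [|r s' t F K' FF _ st _ IH] Hs.
  by have [|u []//] := Hs (s%:num - 1)%R; rewrite ltrBlDr ltrDl.
(* either the rectangle stays away from s on the left, and K' comes close to s,
   or the rectangle comes close to s *)
have [[c1 cs1 Hc1]|H1] := pselect (exists2 c : R, (c < s%:num)%R & forall u,
    rectangle F s' t (w, u) -> ~~ (c < u%:num <= s%:num)%R).
  right; apply: IH => c2 cs2.
  have [|u [Ku]] := Hs (Num.max c1 c2); first by rewrite gt_max cs1.
  case: Ku => [/Hc1|Ku].
  - by move=> /negP nc /andP[]; rewrite gt_max => /andP[c1u _] us; case: nc; rewrite c1u.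
  - by move=> /andP[]; rewrite gt_max => /andP[_ c2u] us; exists u; rewrite c2u.
have H2 c : (c < s%:num)%R -> exists u,
    rectangle F s' t (w, u) /\ (c < u%:num <= s%:num)%R.
  move=> cs; apply: contrapT => H; apply: H1; exists c => // u ru.
  by apply/negP => cu; apply: H; exists u.
left; have [|u [[/= Fw /andP[s'u ut]] /andP[_ us]]] := H2 (s%:num - 1)%R.
  by rewrite ltrBlDr ltrDl.
split => //=; rewrite (le_trans s'u us)/= leNgt; apply/negP => /H2[v [[_ /=]]].
by move=> /andP[_ vt] /andP[tv _]; have := lt_le_trans tv vt; rewrite ltxx.
Qed.

Lemma elementary_bounded K : elementary K ->
  exists M : R, forall p, K p -> (p.2%:num <= M)%R.
Proof.
elim=> [|r s t F K' _ _ _ _ [M HM]]; first by exists 0%R.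
exists (Num.max t%:num M) => p [[_ /andP[_ pt]]|/HM pM]; rewrite le_max ?pt//.
by rewrite pM orbT.
Qed.

(** The time is the supremum of the debuts of the K n. Where it is finite, it is
    approached from the left by points of each K m, hence belongs to K m; where
    all sections are nonempty, the debuts are bounded because K 0 is. *)
Lemma elementary_bigcap_section (K : nat -> set (T * {nonneg R})) :
  (forall n, elementary (K n)) -> (forall n, K n.+1 `<=` K n) ->
  exists rho, [/\ predictable_time Fil rho, graph rho `<=` \bigcap_n K n &
    \bigcap_n (fst @` K n) `<=` [set w | rho w < +oo]].
Proof.
move=> EK /subset_nonincreasing Kdec.
have /choice[D HD] : forall n, exists rho, predictable_time Fil rho /\ debut rho (K n).
  by move=> n; exact: elementary_debut.
have D0 n w : 0 <= D n w by have [[[]]] := HD n.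
have Dfin n w : D n w < +oo -> exists2 u, D n w = u%:num%:E & K n (w, u).
  move=> /(nonneg_time (D0 n w))[u Du]; exists u => //.
  by have [_ [DK _]] := HD n; exact: DK.
have Dnd w n k : (n <= k)%N -> D n w <= D k w.
  move=> nk; have [Dk|] := ltP (D k w) +oo; last by rewrite leye_eq => /eqP->; rewrite leey.
  have [u -> Ku] := Dfin _ _ Dk; have [_ [_]] := HD n.
  by move=> /(_ (w, u)); apply; exact: Kdec Ku.
exists (fun w => ereal_sup (range (D ^~ w))); split.
- by apply: predictable_sup => // n; case: (HD n).
- move=> [w s]; rewrite /graph /= => supE n _.
  have Ds k : D k w <= s%:num%:E.
    by rewrite -supE; apply: ereal_sup_ubound; exists k.
  apply: elementary_left_closed => // c cs.
  have : c%:E < ereal_sup (range (D ^~ w)) by rewrite supE lte_fin.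
  move=> /ereal_sup_gt[_ [k _ <-]] cD.
  have [|u Du Ku] := Dfin (maxn n k) w; first exact: le_lt_trans (Ds _) (ltry _).
  exists u; split; first exact: Kdec (leq_maxl _ _) _ Ku.
  rewrite -lte_fin -lee_fin -Du Ds andbT; apply: lt_le_trans cD _.
  by apply: Dnd; exact: leq_maxr.
- move=> w Hw /=; have [M HM] := elementary_bounded (EK 0%N).
  apply: (@le_lt_trans _ _ M%:E); last exact: ltry.
  apply: ge_ereal_sup => _ [n _ <-].
  have [[w' u] Ku /= ww'] := Hw n I; rewrite ww' in Ku.
  have [_ [_ /(_ _ Ku) /=]] := HD n; move/le_trans; apply.
  by rewrite lee_fin; apply: (HM (w, u)); exact: Kdec Ku.
Qed.

End elementary.

(** * Decomposition of accessible sets *)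

Section decomposition.
Context (R : realType) (T : Type) (Fil : {nonneg R} -> set (set T)).
Hypothesis hFil : filtration Fil.

Local Notation analytic := (souslin (elementary Fil)).
Local Notation bianalytic := (bisouslin (elementary Fil)).

(** The rectangles start at q + 1 / (n + 1), strictly after the time q at which F
    is known. *)
Lemma analytic_after (q : {nonneg R}) (F : set T) : Fil q F ->
  analytic [set p | F p.1 /\ (q%:num < p.2%:num)%R].
Proof.
move=> FF.
have s0 n : (0 <= q%:num + n.+1%:R^-1)%R by [].
have t0 n : (0 <= q%:num + n%:R)%R by [].
pose s n := NngNum (s0 n); pose t n := NngNum (t0 n).
rewrite [X in analytic X](_ : _ = \bigcup_n \bigcup_k rectangle F (s n) (t k)).
  apply: souslin_bigcup => n; apply: souslin_bigcup => k.
  apply: souslin_paving; apply: elementary_rectangle FF _.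
  by split=> [|_] /=; rewrite ?lerDl ?ltrDl.
apply/seteqP; split=> -[w v] /=.
- case=> Fw qv.
  pose n := Num.truncn ((v%:num - q%:num)^-1)%R.
  pose k := Num.truncn (v%:num)%R.
  exists n => //; exists k.+1 => //; split => //=; apply/andP; split.
    rewrite -lerBrDl -[leRHS]invrK lef_pV2 ?posrE ?invr_gt0 ?subr_gt0//.
    exact/ltW/truncnS_gt.
  by apply: le_trans (ltW (truncnS_gt _)) _; rewrite lerDr.
- case=> n _ [k _ [Fw /andP[sv _]]]; split => //.
  by apply: lt_le_trans sv; rewrite ltrDl.
Qed.

Lemma bianalytic_salg : sigma_algebra setT bianalytic.
Proof.
apply: sigma_algebra_bisouslin; first exact: elementary0.
pose t n := NngNum (ler0n R n).
rewrite [X in analytic X](_ : _ = \bigcup_n rectangle setT (time0 R) (t n)).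
  apply: souslin_bigcup => n; apply: souslin_paving.
  apply: (@elementary_rectangle _ _ _ (time0 R)); first exact: (salg_setT (filtration_salg hFil _)).
  by split=> //=; rewrite ltxx.
apply/seteqP; split=> -[w v] // _; exists (Num.truncn v%:num).+1 => //.
by split=> //=; rewrite ge0/=; exact/ltW/truncnS_gt.
Qed.

(** Rational times separate: tau w < t when some q satisfies tau w <= q < t, and
    t <= tau w when every q satisfies t <= q or q < tau w. Both events on tau are
    known at time q. *)
Lemma bianalytic_after tau : optional_time Fil tau ->
  bianalytic [set p | tau p.1 < p.2%:num%:E].
Proof.
move=> [tau0 tauF]; have [q Hq] := countable_dense_times R; split.
- rewrite [X in analytic X](_ : _ =
    \bigcup_n [set p | tau p.1 <= (q n)%:num%:E /\ ((q n)%:num < p.2%:num)%R]).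
    by apply: souslin_bigcup => n; exact: (analytic_after (tauF (q n))).
  apply/seteqP; split=> -[w v] /=.
  + by move=> /(Hq _ _ (tau0 w))[n [tq qv]]; exists n => //=; rewrite ltW// -lte_fin.
  + by case=> n _ /= [tq qv]; apply: le_lt_trans tq _; rewrite lte_fin.
- rewrite [X in analytic X](_ : _ = \bigcap_n (rectangle setT (time0 R) (q n) `|`
    [set p | (~` [set w | tau w <= (q n)%:num%:E]) p.1 /\
             ((q n)%:num < p.2%:num)%R])).
    apply: souslin_bigcap => n; apply: souslin_setU.
      apply: souslin_paving; apply: (@elementary_rectangle _ _ _ (time0 R)).
        exact: (salg_setT (filtration_salg hFil _)).
      by split=> //=; rewrite ltxx.
    apply: analytic_after; apply: (salg_setC (filtration_salg hFil _)); exact: tauF.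
  apply/seteqP; split=> -[w v] /=.
  + move=> /negP; rewrite -leNgt => vt n _ /=.
    have [vq|qv] := leP v%:num (q n)%:num; first by left; split=> //=; rewrite ge0.
    right; split=> //; apply/negP; rewrite -ltNge; apply: lt_le_trans vt.
    by rewrite lte_fin.
  + move=> H /(Hq _ _ (tau0 w))[n [tq qv]]; case: (H n I) => /= -[].
      by move=> _ /andP[_]; rewrite leNgt -lte_fin qv.
    by move=> + _; apply; exact: ltW.
Qed.

(** For rho announced by a, and t > 0 or rho w > 0, rho w <= t means that a n w < t
    for all n. Only the time 0 where rho vanishes is missing, and it forms a
    rectangle Z over an event known at time 0. *)
Lemma bianalytic_stoch_itv rho : predictable_time Fil rho -> bianalytic (stoch_itv rho).
Proof.
move=> /(predictable_timeP)[[rho0 rhoF] [a [aF afin alt nda acvg]]].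
have bS := bianalytic_salg.
pose Z : set (T * {nonneg R}) :=
  rectangle [set w | rho w <= (time0 R)%:num%:E] (time0 R) (time0 R).
have bZ : bianalytic Z.
  split.
    apply: souslin_paving; apply: (@elementary_rectangle _ _ _ (time0 R)).
      exact: rhoF.
    by split=> //=; rewrite ltxx.
  rewrite [X in analytic X](_ : _ =
    [set p | setT p.1 /\ ((time0 R)%:num < p.2%:num)%R] `|`
    rectangle (~` [set w | rho w <= (time0 R)%:num%:E]) (time0 R) (time0 R)).
    apply: souslin_setU; first by apply: analytic_after; exact: (salg_setT (filtration_salg hFil _)).
    apply: souslin_paving; apply: (@elementary_rectangle _ _ _ (time0 R)).
      by apply: (salg_setC (filtration_salg hFil _)); exact: rhoF.
    by split=> //=; rewrite ltxx.
  apply/seteqP; split=> -[w v]; rewrite /Z /rectangle /=.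
  + move=> H; have [v0|v0] := ltP 0%R v%:num; first by left.
    right; split; last by rewrite ge0.
    by move=> r0; apply: H; split=> //; rewrite ge0.
  + case=> -[]; first by move=> _ v0 [_ /andP[_]]; rewrite leNgt v0.
    by move=> nr _ [].
rewrite [X in bianalytic X](_ : _ = Z `|` \bigcap_n [set p | a n p.1 < p.2%:num%:E]).
  apply: (salg_setU bS) => //; apply: (salg_bigcap bS) => n.
  exact: bianalytic_after.
apply/seteqP; split=> -[w v]; rewrite /Z /rectangle /stoch_itv /=.
- move=> rv; have [v0|v0] := leP v%:num 0%R.
    left; split; last by rewrite ge0.
    by apply: le_trans rv _; rewrite lee_fin.
  right=> n _ /=; have [r0|r0] := ltP 0 (rho w).
    exact: lt_le_trans (alt n w r0) rv.
  by have [_ /le_lt_trans] := afin n w; apply; apply: le_lt_trans r0 _; rewrite lte_fin.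
- case=> [[r0 _]|H]; first by apply: le_trans r0 _; rewrite lee_fin ge0.
  rewrite leNgt; apply/negP => /acvg[n va].
  by have := lt_trans va (H n I); rewrite ltxx.
Qed.

Lemma bianalytic_graph rho : predictable_time Fil rho -> bianalytic (graph rho).
Proof.
move=> rhoP; have bS := bianalytic_salg.
rewrite [X in bianalytic X](_ : _ = stoch_itv rho `&` ~` [set p | rho p.1 < p.2%:num%:E]).
  apply: (salg_setI bS); first exact: bianalytic_stoch_itv.
  by apply: (salg_setC bS); apply: bianalytic_after; case: rhoP.
apply/seteqP; split=> -[w v]; rewrite /graph /stoch_itv /=.
- by move=> ->; rewrite ltxx.
- by move=> [rv /negP]; rewrite -leNgt => vr; apply/eqP; rewrite eq_le rv.
Qed.

Definition bianalytic_off_graphs (A : set (T * {nonneg R})) :=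
  exists B (rho : nat -> T -> \bar R),
    [/\ bianalytic B, forall m, predictable_time Fil (rho m) &
        forall p, (forall m, ~ graph (rho m) p) -> (A p <-> B p)].

(** Up to countably many graphs of predictable times, sets can be complemented
    and united countably, so it is enough to treat [[tau, oo[[. It differs from
    { (w, t) | tau w < t } by the graph of tau, which is covered by graphs of
    predictable times. *)
Lemma accessible_off_graphs A : accessible_sigma_algebra Fil A ->
  bianalytic_off_graphs A.
Proof.
have bS := bianalytic_salg.
have infP : predictable_time Fil (fun=> +oo).
  have [rho [rhoP [+ _]]] := elementary_debut hFil (elementary0 Fil).
  move=> grho; suff -> : (fun=> +oo) = rho by [].
  apply/funext => w; apply/esym; have [[r0 _] _] := rhoP.
  have [rfin|] := ltP (rho w) +oo; last by rewrite leye_eq => /eqP.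
  by have [t rt] := nonneg_time (r0 w) rfin; have [] := grho (w, t) rt.
move: A; apply: smallest_sub; first split.
- exists set0, (fun _ _ => +oo); split => //; exact: salg_set0.
- move=> A [B [rho [bB rhoP AB]]]; exists (~` B), rho; split => //.
    exact: salg_setC.
  move=> p /AB [AB1 AB2]; rewrite setTD; split=> /= H; apply: contra_not H => //.
- move=> A /choice[B /choice[rho H]].
  pose split n : nat * nat := odflt (0, 0)%N (unpickle n).
  exists (\bigcup_n B n), (fun i => rho (split i).1 (split i).2); split.
  + by apply: (salg_bigcup bS) => n; case: (H n).
  + by move=> i; case: (H (split i).1).
  + move=> p np; have AB n : A n p <-> B n p.
      have [_ _] := H n; apply => m; have := np (pickle (n, m)).
      by rewrite /split pickleK.
    by split=> -[n _ /AB]; exists n.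
- move=> _ [tau [tauF [rho [rhoP taurho]]] <-].
  exists [set p | tau p.1 < p.2%:num%:E], rho; split => //.
    exact: bianalytic_after.
  move=> p np; rewrite /stoch_itv /=; split; last exact: ltW.
  rewrite le_eqVlt => /orP[/eqP taup|//].
  by have [m _ /np] := taurho p taup.
Qed.

(** Accessible sets are optional: the event that (w, rho w) is in A and rho w <= u
    is known at time u. For A = [[tau, oo[[ one removes from the event rho <= u
    the event rho < tau, which is detected at u itself or at some time q <= u of a
    countable dense set. *)
Lemma optional_trace A rho (u : {nonneg R}) :
  accessible_sigma_algebra Fil A -> optional_time Fil rho ->
  Fil u [set w | exists t : {nonneg R},
    [/\ rho w = t%:num%:E, A (w, t) & (t%:num <= u%:num)%R]].
Proof.
move=> + [rho0 rhoF]; move: A.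
have FS := filtration_salg hFil u; have [q Hq] := countable_dense_times R.
have leE w : rho w <= u%:num%:E ->
    exists2 t : {nonneg R}, rho w = t%:num%:E & (t%:num <= u%:num)%R.
  move=> ru; have [t rt] := nonneg_time (rho0 w) (le_lt_trans ru (ltry _)).
  by exists t => //; rewrite -lee_fin -rt.
apply: smallest_sub; first split.
- rewrite [X in Fil u X](_ : _ = set0); first exact: (salg_set0 FS).
  by apply/seteqP; split=> w //= [t []].
- move=> A HA; rewrite [X in Fil u X](_ : _ =
    [set w | rho w <= u%:num%:E] `&` ~` [set w | exists t : {nonneg R},
    [/\ rho w = t%:num%:E, A (w, t) & (t%:num <= u%:num)%R]]).
    by apply: (salg_setI FS); [exact: rhoF|exact: (salg_setC FS)].
  apply/seteqP; split=> w /=.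
  + case=> t [rt [_ nA] tu]; split; first by rewrite rt lee_fin.
    case=> t' [rt' At' _]; apply: nA; suff -> : t = t' by [].
    by apply: val_inj; apply: EFin_inj; rewrite -[LHS]rt -[RHS]rt'.
  + move=> [/leE[t rt tu] nA]; exists t; split => //; split => // At.
    by apply: nA; exists t.
- move=> A HA; rewrite [X in Fil u X](_ : _ = \bigcup_n [set w |
    exists t : {nonneg R}, [/\ rho w = t%:num%:E, A n (w, t) & (t%:num <= u%:num)%R]]).
    exact: (salg_bigcup FS).
  apply/seteqP; split=> w /=.
  + by case=> t [rt [n _ An] tu]; exists n => //; exists t.
  + by case=> n _ [t [rt An tu]]; exists t; split => //; exists n.
- move=> _ [tau [[tau0 tauF] _] <-].
  pose E := (\bigcup_n if ((q n)%:num <= u%:num)%R then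
      [set w | rho w <= (q n)%:num%:E] `&` ~` [set w | tau w <= (q n)%:num%:E]
      else set0) `|` ~` [set w | tau w <= u%:num%:E].
  rewrite [X in Fil u X](_ : _ = [set w | rho w <= u%:num%:E] `&` ~` E).
    apply: (salg_setI FS); first exact: rhoF.
    apply: (salg_setC FS); apply: (salg_setU FS).
      apply: (salg_bigcup FS) => n; case: ifP => qu; last exact: (salg_set0 FS).
      by apply: (salg_setI FS); [|apply: (salg_setC FS)]; apply: fil_le qu _.
    by apply: (salg_setC FS).
  apply/seteqP; split=> w; rewrite /stoch_itv /=.
  + case=> t [rt taut tu]; split; first by rewrite rt lee_fin.
    case=> [[n _]|].
      by case: ifP => // qu [/=]; rewrite rt => tq ntq; apply: ntq; exact: le_trans tq.
    by apply; apply: le_trans taut _; rewrite lee_fin.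
  + move=> [/leE[t rt tu] nE]; exists t; split => //.
    rewrite -rt leNgt; apply/negP => rtau; apply: nE.
    have [tauu|utau] := leP (tau w) u%:num%:E; last first.
      by right; apply/negP; rewrite -ltNge.
    left; have [n [rq qtau]] := Hq _ _ (rho0 w) rtau; exists n => //.
    rewrite -lee_fin (ltW (lt_le_trans qtau tauu)); split=> /=; first exact: ltW.
    by apply/negP; rewrite -ltNge.
Qed.

(** Restricting rho to the event that (w, rho w) belongs to A gives an optional
    time by [optional_trace], and its graph is inside that of rho. *)
Lemma accessible_restriction A rho :
  accessible_sigma_algebra Fil A -> predictable_time Fil rho ->
  exists sigma, [/\ accessible_time Fil sigma, graph sigma `<=` A &
    graph rho `&` A `<=` graph sigma].
Proof.
move=> AA rhoP; have [rhoF _] := rhoP.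
pose Q w := exists t : {nonneg R}, rho w = t%:num%:E /\ A (w, t).
have sgE w t : (if `[< Q w >] then rho w else +oo) = t%:num%:E ->
    rho w = t%:num%:E /\ A (w, t).
  case: ifPn => // /asboolP[t' [rt' At']] rt; split => //.
  suff -> : t = t' by [].
  by apply: val_inj; apply: EFin_inj; rewrite -[LHS]rt -[RHS]rt'.
exists (fun w => if `[< Q w >] then rho w else +oo); split.
- split; last first.
    exists (fun=> rho); split => // -[w t] /sgE [rt _]; by exists 0%N.
  split=> [w|u]; first by case: ifP => // _; case: rhoF.
  rewrite [X in Fil u X](_ : _ = [set w | exists t : {nonneg R},
    [/\ rho w = t%:num%:E, A (w, t) & (t%:num <= u%:num)%R]]).
    exact: optional_trace.
  apply/seteqP; split=> w /=.
  + case: ifPn => // /asboolP[t [rt At]] ru; exists t; split => //.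
    by rewrite -lee_fin -rt.
  + case=> t [rt At tu]; rewrite asboolT; first by rewrite rt lee_fin.
    by exists t.
- by move=> [w t] /sgE[].
- move=> [w t] [rt At]; rewrite /graph /= asboolT//.
  by exists t.
Qed.

End decomposition.

(** * Outer probability *)

Section outer_probability_theory.
Context (R : realType) (d : measure_display) (T : measurableType d)
  (P : probability T R).

Lemma outer_probability_le A B : A `<=` B ->
  outer_probability P A <= outer_probability P B.
Proof.
move=> AB; apply: ereal_inf_le_tmp => _ [E [BE mE] <-]; exists E => //.
by split => //; exact: subset_trans BE.
Qed.

Lemma outer_probability_le_measurable A E : measurable E -> A `<=` E ->
  outer_probability P A <= P E.
Proof. by move=> mE AE; apply: ereal_inf_lbound; exists E. Qed.

Lemma outer_probability_fin_num A : outer_probability P A \is a fin_num.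
Proof.
rewrite fin_numElt; apply/andP; split.
  apply: (@lt_le_trans _ _ 0); first exact: ltNy0.
  by apply: le_ereal_inf_tmp => _ [E _ <-].
apply: le_lt_trans (ltry 1).
apply: le_trans (outer_probability_le_measurable measurableT (@subsetT _ A)) _.
exact: probability_le1.
Qed.

(** If all B n had outer probability at most c, choose measurable E n above B n
    with P (E n) <= c + e. The sets G n = \bigcap_(k >= n) E k still contain B n,
    increase, and have probability at most c + e; so does their union. *)
Lemma outer_probability_bigcup (c : R) (B : nat -> set T) :
  (forall n, B n `<=` B n.+1) -> c%:E < outer_probability P (\bigcup_n B n) ->
  exists n, c%:E < outer_probability P (B n).
Proof.
move=> ndB cB; apply: contrapT => H.
have {}H n : outer_probability P (B n) <= c%:E.
  by rewrite leNgt; apply/negP => cn; apply: H; exists n.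
move: cB; rewrite ltNge => /negP; apply; apply/lee_addgt0Pr => e e0.
have /choice[E HE] n : exists E, [/\ B n `<=` E, measurable E & P E <= c%:E + e%:E].
  have : outer_probability P (B n) < c%:E + e%:E.
    by apply: le_lt_trans (H n) _; rewrite -EFinD lte_fin ltrDl.
  by move=> /ereal_inf_lt[_ [E [BE mE] <-]] PE; exists E; split=> //; exact: ltW.
have BB : {homo B : n k / (n <= k)%N >-> n `<=` k}.
  by apply: homo_leq ndB => [L //|L L1 L2 H1 H2]; exact: subset_trans H1 H2.
pose G n := \bigcap_(k in [set k | (n <= k)%N]) E k.
have mG n : measurable (G n).
  by apply: bigcap_measurableType => k _; case: (HE k).
have mUG : measurable (\bigcup_n G n) by exact: bigcup_measurable.
apply: (@le_trans _ _ (P (\bigcup_n G n))).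
  apply: outer_probability_le_measurable => // w [n _ Bw].
  by exists n => // k nk; have [BE _ _] := HE k; apply: BE; exact: BB Bw.
have cvG : P \o G @ \oo --> P (\bigcup_n G n).
  apply: nondecreasing_cvg_mu => //.
  by move=> n k nk; apply/subsetPset => w Gw j /= kj; apply: Gw => /=; exact: leq_trans kj.
apply: cvge_to_le cvG _; apply: nearW => n /=.
have [_ mE PE] := HE n; apply: le_trans PE.
by apply: le_measure; rewrite ?inE// => w; apply => /=.
Qed.

Lemma nonincreasing_probability_ge (c : R) (E : nat -> set T) :
  (forall n, measurable (E n)) -> (forall n, E n.+1 `<=` E n) ->
  (forall n, c%:E <= P (E n)) -> c%:E <= P (\bigcap_n E n).
Proof.
move=> mE /subset_nonincreasing Edec cE.
have cvE : P \o E @ \oo --> P (\bigcap_n E n).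
  apply: nonincreasing_cvg_mu => //.
  - by apply: le_lt_trans (ltry 1); exact: probability_le1.
  - exact: bigcap_measurableType.
  - by move=> n k nk; apply/subsetPset; exact: Edec.
by apply: cvge_to_ge cvE _; apply: nearW => n; exact: cE.
Qed.

End outer_probability_theory.

(** * Minima of accessible times *)

Section accessible.
Context (R : realType) (T : Type) (Fil : {nonneg R} -> set (set T)).
Hypothesis hFil : filtration Fil.

Lemma accessible_predictable rho : predictable_time Fil rho -> accessible_time Fil rho.
Proof.
move=> rhoP; split; first by case: rhoP.
by exists (fun=> rho); split => // p rp; exists 0%N.
Qed.

Lemma graph_min sigma tau :
  graph (fun w => mine (sigma w) (tau w)) `<=`
  (graph sigma `|` graph tau : set (T * {nonneg R})).
Proof.
by move=> [w t]; rewrite /graph /=; case: leP => _ ?; [left|right].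
Qed.

(** The two covering sequences are interleaved. *)
Lemma accessible_min sigma tau :
  accessible_time Fil sigma -> accessible_time Fil tau ->
  accessible_time Fil (fun w => mine (sigma w) (tau w)).
Proof.
move=> [sF [a [aP sa]]] [tF [b [bP tb]]]; split; first exact: optional_min.
exists (fun i => if odd i then a i./2 else b i./2); split.
  by move=> i; case: ifP.
move=> p /graph_min[/sa|/tb] [i _ Hi].
  by exists i.*2.+1 => //=; rewrite odd_double/= uphalf_double.
by exists i.*2 => //=; rewrite odd_double/= doubleK.
Qed.

(** The minimum of rho and of the first n times sigma m: its graph is made of
    points of theirs, and it is finite as soon as one of them is. *)
Lemma accessible_min_upto (A : set (T * {nonneg R})) rho (sigma : nat -> T -> \bar R) n :
  accessible_time Fil rho -> graph rho `<=` A ->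
  (forall m, accessible_time Fil (sigma m)) -> (forall m, graph (sigma m) `<=` A) ->
  exists tau, [/\ accessible_time Fil tau, graph tau `<=` A &
    [set w | rho w < +oo] `|`
      \bigcup_(m in [set m | (m < n)%N]) [set w | sigma m w < +oo]
    `<=` [set w | tau w < +oo]].
Proof.
move=> rA rG sA sG; elim: n => [|n [tau [tA tG tfin]]].
  by exists rho; split => // w [|[]].
exists (fun w => mine (tau w) (sigma n w)); split.
- exact: accessible_min.
- by move=> p /graph_min[/tG|/sG].
- move=> w /= H; rewrite gt_min.
  case: H => [rw|[m /=]]; first by apply/orP; left; apply: tfin; left.
  rewrite ltnS leq_eqVlt => /orP[/eqP -> ->|mn mw]; first by rewrite orbT.
  by apply/orP; left; apply: tfin; right; exists m.
Qed.

End accessible.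

Lemma measurable_optional_finite (R : realType) (d : measure_display)
    (T : measurableType d) (Fil : {nonneg R} -> set (set T)) tau :
  <<s \bigcup_(t in [set: {nonneg R}]) Fil t >> `<=` measurable ->
  optional_time Fil tau -> measurable [set w | tau w < +oo].
Proof.
move=> hFilT [tau0 tauF].
rewrite [X in measurable X](_ : _ =
  \bigcup_n [set w | tau w <= (NngNum (ler0n R n))%:num%:E]).
  apply: bigcup_measurable => n _; apply: hFilT; apply: sub_gen_smallest.
  by exists (NngNum (ler0n R n)).
apply/seteqP; split=> w /=.
- move=> /(nonneg_time (tau0 w))[t taut].
  by exists (Num.truncn t%:num).+1 => //=; rewrite taut lee_fin; exact/ltW/truncnS_gt.
- by case=> n _ /= /le_lt_trans; apply; exact: ltry.
Qed.

(** * The section theorem *)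

Theorem mainTheorem4 (R : realType) (d : measure_display)
    (T : measurableType d) (P : probability T R)
    (Fil : {nonneg R} -> set (set T))
    (hFil : filtration Fil)
    (hFilT : <<s \bigcup_(t in [set: {nonneg R}]) Fil t >> `<=` measurable)
    (A : set (T * {nonneg R})) (hA : accessible_sigma_algebra Fil A)
    (eps : R) (heps : (0 < eps)%R) :
  exists tau : T -> \bar R,
    [/\ accessible_time Fil tau,
        graph tau `<=` A &
        outer_probability P (fst @` A) - P [set w | tau w < +oo] <= eps%:E].
Proof.
have [B [rho [bB rhoP AB]]] := accessible_off_graphs hFil hA.
have /choice[sigma Hs] m := accessible_restriction hFil hA (rhoP m).
pose B' := B `&` \bigcap_m ~` graph (rho m).
have SB' : souslin (elementary Fil) B'.
  have bS := bianalytic_salg hFil.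
  suff [] : bisouslin (elementary Fil) B' by [].
  apply: (salg_setI bS) => //; apply: (salg_bigcap bS) => m.
  by apply: (salg_setC bS); exact: bianalytic_graph.
have B'A : B' `<=` A by move=> p [Bp np]; apply/AB => // m; exact: np.
pose C n := \bigcup_(m in [set m | (m < n)%N]) [set w | sigma m w < +oo].
have mfin := measurable_optional_finite hFilT.
have mC n : measurable (C n).
  by apply: bigcup_measurable => m _; apply: mfin; case: (Hs m) => -[].
pose c : R := (fine (outer_probability P (fst @` A)) - eps)%R.
have cA : c%:E < outer_probability P (fst @` A).
  by rewrite -[ltRHS]fineK ?outer_probability_fin_num// lte_fin gtrBl.
(* finitely many sigma m, together with B', suffice to exceed c *)
have [n cn] : exists n, c%:E < outer_probability P (fst @` B' `|` C n).
  apply: outer_probability_bigcup.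
    move=> n w [|[m mn mw]]; [by left|right; exists m => //=].
    exact: leqW.
  apply: lt_le_trans cA _; apply: outer_probability_le => _ [[w t] Awt <-] /=.
  have [[m rm]|nr] := pselect (exists m, graph (rho m) (w, t)).
    exists m.+1 => //; right; exists m => //=.
    have [_ _ /(_ (w, t) (conj rm Awt))] := Hs m.
    by rewrite /graph /= => ->; exact: ltry.
  exists 0%N => //; left; exists (w, t) => //; split.
    by apply/AB => // m rm; apply: nr; exists m.
  by move=> m _ rm; apply: nr; exists m.
(* adding the fixed event C n to the projection leaves a capacity *)
pose J (X : set (T * {nonneg R})) := outer_probability P (fst @` X `|` C n).
have [||K [EK Kdec cK KB]] := @capacitability R _ _
  (elementary0 Fil) (@elementary_setU _ _ Fil) (@elementary_setI _ _ Fil hFil)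
  J c%:E B' _ _ SB' cn.
- by move=> X Y XY; apply: outer_probability_le; apply: setSU; exact: image_subset.
- move=> X Xnd cX; apply: outer_probability_bigcup.
    by move=> k; apply: setSU; apply: image_subset.
  apply: lt_le_trans cX _; apply: outer_probability_le => w [[p [k _ Xp] <-]|Cw].
    by exists k => //; left; exists p.
  by exists 0%N => //; right.
have [rho0 [rho0P rho0K Kfin]] := elementary_bigcap_section hFil EK Kdec.
have [|m|m|tau [tauA tauG taufin]] :=
  @accessible_min_upto _ _ Fil hFil A rho0 sigma n (accessible_predictable rho0P).
- by apply: subset_trans rho0K _; exact: subset_trans KB B'A.
- by case: (Hs m).
- by case: (Hs m).
exists tau; split => //.
have mtau : measurable [set w | tau w < +oo] by apply: mfin; case: tauA.
have mK k : measurable (fst @` K k `|` C n).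
  apply: measurableU => //; have [D [[DF _] [DK KD]]] := elementary_debut hFil (EK k).
  rewrite (_ : fst @` K k = [set w | D w < +oo]); first exact: mfin.
  apply/seteqP; split=> [_ [p Kp <-]|w /=].
    by apply: le_lt_trans (KD p Kp) _; exact: ltry.
  have [D0 _] := DF; move=> /(nonneg_time (D0 w))[t Dt].
  by exists (w, t) => //; exact: DK.
have : c%:E <= P [set w | tau w < +oo].
  apply: (@le_trans _ _ (P (\bigcap_k (fst @` K k `|` C n)))).
    apply: nonincreasing_probability_ge => // k.
      by apply: setSU; apply: image_subset.
    apply: le_trans (ltW (cK k)) _.
    exact: outer_probability_le_measurable.
  apply: le_measure; rewrite ?inE//; first exact: bigcap_measurableType.
  move=> w Hw; apply: taufin; have [Cw|nC] := pselect (C n w); first by right.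
  by left; apply: Kfin => k _; case: (Hw k I).
rewrite leeBlDr ?fin_num_measure// => cP.
rewrite -[leLHS]fineK ?outer_probability_fin_num//.
apply: (@le_trans _ _ (eps%:E + c%:E)); last by rewrite leeD2l.
by rewrite -EFinD lee_fin /c addrC subrK.
Qed.
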